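(* Let $n$ be a positive integer such that $2^6\mid n$ or $p^5\mid n$ for some odd prime $p$. Then there exists a group $G$ of order $n$ such that $B_0(G)\ne0$.
   Context: For a finite group $G$, the Bogomolov multiplier is $B_0(G)=\bigcap_A\mathrm{Ker}\{\mathrm{res}:H^2(G,\mathbb{Q}/\mathbb{Z})\to H^2(A,\mathbb{Q}/\mathbb{Z})\}$, where $A$ runs over all bicyclic subgroups of $G$ (cyclic groups or direct products of two cyclic groups). *)

(* Defs.v *)
From HB Require Import structures.
From mathcomp Require Import all_boot all_order all_algebra all_fingroup all_solvable.
Set Implicit Arguments. Unset Strict Implicit. Unset Printing Implicit Defensive.
Import GRing.Theory Num.Theory.

(* Q/Z is modelled by rat modulo the integers:  a = b in Q/Z  iff  a - b in Z. *)
Definition qz_eq (a b : rat) : Prop := ((a - b)%R \is a Num.int).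

(* Inhomogeneous 2-cocycles of a subgroup A of gT with values in Q/Z
   (trivial action), represented by functions gT -> gT -> rat (only values
   on A x A matter). *)
Definition cocycle2 (gT : finGroupType) (A : {set gT}) (f : gT -> gT -> rat) : Prop :=
  forall x y z, x \in A -> y \in A -> z \in A ->
    qz_eq (f y z - f (x * y)%g z + f x (y * z)%g - f x y)%R 0%R.

Definition coboundary2 (gT : finGroupType) (A : {set gT}) (f : gT -> gT -> rat) : Prop :=
  exists g : gT -> rat, forall x y, x \in A -> y \in A ->
    qz_eq (f x y) (g y - g (x * y)%g + g x)%R.

(* Bicyclic subgroups of G: subgroups that are cyclic or a direct product of
   two cyclic groups, i.e. internal direct products <[x]> \x <[y]>
   (the cyclic case is y = 1). *)
Definition bicyclic (gT : finGroupType) (G A : {set gT}) : Prop :=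
  A \subset G /\ exists x y : gT, (<[x]> \x <[y]>)%g = A.

Definition in_B0 (gT : finGroupType) (G : {group gT}) (f : gT -> gT -> rat) : Prop :=
  cocycle2 G f /\ forall A : {group gT}, bicyclic G A -> coboundary2 A f.

Definition B0_nontrivial (gT : finGroupType) (G : {group gT}) : Prop :=
  exists f : gT -> gT -> rat, in_B0 G f /\ ~ coboundary2 G f.

(* Main.v *)
(** Suppose that E is a finite group with a central element z of prime order p
    that lies in [E, E], while no nontrivial commutator of E lies in <z>.  Let f
    be the class of the extension E of G = E/<z>, pushed to Q/Z along z |-> 1/p.
    On a subgroup A of G the class f vanishes iff the character z |-> 1/p of <z>
    extends to the preimage of A.  If A is bicyclic, this preimage is abelian,
    because lifts of commuting elements have their commutator in <z>; hence the
    character extends.  It does not extend to E, as it is nontrivial on [E, E].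

    Such an E of order p^6 (p odd) or 2^7 is obtained as Z/p acting on a central
    extension N of an abelian group M by Z/p.  The element z is (w, 1), where w in
    M and (0, 1) in N are both central commutators: w comes from the action of Z/p
    on M, and (0, 1) from the noncommutativity of N.  A direct factor Z/m does not
    affect any of this, and gives G all the orders p^5 m, resp. 2^6 m. *)
From HB Require Import structures.
Require Import Defs.
From mathcomp Require Import all_boot all_order all_algebra all_fingroup all_solvable.
From mathcomp Require Import ring.
Set Implicit Arguments. Unset Strict Implicit. Unset Printing Implicit Defensive.
Import GRing.Theory Num.Theory.
Local Open Scope ring_scope.

(** * Characters with values in Q/Z and their extension inside abelian groups *)

Lemma qz_eq_refl a : qz_eq a a.
Proof. by rewrite /qz_eq subrr rpred0. Qed.

Lemma qz_eq_sym a b : qz_eq a b -> qz_eq b a.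
Proof. by rewrite /qz_eq -(opprB b a) rpredN. Qed.

Lemma qz_eq_trans b a c : qz_eq a b -> qz_eq b c -> qz_eq a c.
Proof. by move=> ab bc; rewrite /qz_eq -(subrKA b) rpredD. Qed.

Lemma qz_eqD a b c d : qz_eq a b -> qz_eq c d -> qz_eq (a + c) (b + d).
Proof. by move=> ab cd; rewrite /qz_eq opprD addrACA rpredD. Qed.

Lemma qz_eqN a b : qz_eq a b -> qz_eq (- a) (- b).
Proof. by move=> ab; rewrite /qz_eq -opprD rpredN. Qed.

Definition qz_hom (gT : finGroupType) (H : {set gT}) (chi : gT -> rat) : Prop :=
  {in H &, forall u v, qz_eq (chi (u * v)%g) (chi u + chi v)}.

Lemma qz_hom1 (gT : finGroupType) (H : {group gT}) chi :
  qz_hom H chi -> qz_eq (chi 1%g) 0.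
Proof.
move=> /(_ _ _ (group1 H) (group1 H)); rewrite mulg1 => /qz_eq_sym.
by rewrite /qz_eq addrK subr0.
Qed.

Lemma qz_homX (gT : finGroupType) (H : {group gT}) chi u k :
  qz_hom H chi -> u \in H -> qz_eq (chi (u ^+ k)%g) (chi u *+ k).
Proof.
move=> homH Hu; elim: k => [|k IHk]; first by rewrite expg0 mulr0n; apply: qz_hom1 homH.
rewrite expgS mulrS; apply: qz_eq_trans (homH _ _ Hu (groupX k Hu)) _.
exact: qz_eqD (qz_eq_refl _) IHk.
Qed.

(** The value chi h + c k at h x^k is well defined: two such expressions of one element differ by a
    power of x lying in H, where [chi] and c agree by hypothesis. *)
Lemma qz_hom_adjoin (gT : finGroupType) (B H : {group gT}) x chi c :
    abelian B -> H \subset B -> x \in B -> qz_hom H chi ->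
    (forall k, (x ^+ k)%g \in H -> qz_eq (chi (x ^+ k)%g) (c *+ k)) ->
  exists2 chi', qz_hom (H <*> <[x]>)%g chi' &
    forall h k, h \in H -> qz_eq (chi' (h * x ^+ k)%g) (chi h + c *+ k).
Proof.
move=> abB sHB Bx homH cX.
have cHx h : h \in H -> commute h x.
  by move=> Hh; apply: (centsP abB) => //; apply: (subsetP sHB).
have wdW h h' k k' : (k' <= k)%N -> h \in H -> h' \in H ->
    (h * x ^+ k = h' * x ^+ k')%g -> qz_eq (chi h + c *+ k) (chi h' + c *+ k').
  move=> lek Hh Hh' E.
  have def_h' : (h * x ^+ (k - k'))%g = h'.
    by apply: (mulIg (x ^+ k')%g); rewrite -mulgA -expgD subnK.
  have Hxk : (x ^+ (k - k'))%g \in H by rewrite -(groupMl _ Hh) def_h'.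
  rewrite -{1}(subnK lek) mulrnDr addrA; apply: qz_eqD (qz_eq_refl _).
  rewrite -def_h'; apply: qz_eq_sym.
  exact: qz_eq_trans (homH _ _ Hh Hxk) (qz_eqD (qz_eq_refl _) (cX _ Hxk)).
have wd h h' k k' : h \in H -> h' \in H ->
    (h * x ^+ k = h' * x ^+ k')%g -> qz_eq (chi h + c *+ k) (chi h' + c *+ k').
  move=> Hh Hh' E; case/orP: (leq_total k' k) => lek; first exact: wdW.
  by apply: qz_eq_sym; apply: wdW.
(* Exponents below the order of x reach all of H <x>, so the default exponent 0 only occurs outside
   this product. *)
pose chi' u := let k := odflt 0%N (omap val [pick k : 'I_#[x]%g | (u * x ^- k)%g \in H]) in
  chi (u * x ^- k)%g + c *+ k.
have chi'E h k : h \in H -> qz_eq (chi' (h * x ^+ k)%g) (chi h + c *+ k).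
  move=> Hh; rewrite /chi'; case: pickP => [i Hi | /= no].
    by apply: wd => //; rewrite mulgKV.
  have /negP[] := no (Ordinal (ltn_pmod k (order_gt0 x))).
  by rewrite /= -expg_mod_order mulgK.
exists chi' => // u v.
rewrite norm_joinEr; last first.
  by rewrite cycle_subG (subsetP (cent_sub _)) //; apply/centP => h /cHx.
case/mulsgP=> h _ Hh /cycleP[k ->] -> /mulsgP[h' _ Hh' /cycleP[k' ->] ->].
have -> : (h * x ^+ k * (h' * x ^+ k') = h * h' * x ^+ (k + k'))%g.
  by rewrite expgD !mulgA -(mulgA h _ h') -(commuteX k (cHx h' Hh')) !mulgA.
apply: qz_eq_trans (chi'E _ _ (groupM Hh Hh')) _.
apply: qz_eq_trans (qz_eqD (homH _ _ Hh Hh') (qz_eq_refl _)) _.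
rewrite mulrnDr addrACA; apply: qz_eq_sym.
by apply: qz_eqD; apply: chi'E.
Qed.

(** This is the divisibility of Q/Z: for the least d > 0 with x^d in H, the value chosen at x is a
    d-th part of that at x^d. It suffices since d divides every k with x^k in H. *)
Lemma qz_hom_extend (gT : finGroupType) (B H : {group gT}) x chi :
    abelian B -> H \subset B -> x \in B -> qz_hom H chi ->
  exists2 chi', qz_hom (H <*> <[x]>)%g chi' & {in H, forall h, qz_eq (chi' h) (chi h)}.
Proof.
move=> abB sHB Bx homH.
have exd : exists d, (0 < d)%N && ((x ^+ d)%g \in H).
  by exists #[x]%g; rewrite order_gt0 expg_order group1.
case: (ex_minnP exd) => d /andP[d_gt0 Hd] min_d.
have [|chi' homH' chi'E] :=
    @qz_hom_adjoin _ B H x chi (chi (x ^+ d)%g / d%:R) abB sHB Bx homH; last first.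
  by exists chi' => // h Hh; have := chi'E h 0%N Hh; rewrite mulg1 mulr0n addr0.
move=> k; rewrite (divn_eq k d) expgD mulnC expgM groupMl; last exact: groupX.
move=> Hr.
have -> : (k %% d = 0)%N.
  case: (posnP (k %% d)%N) => // r_gt0.
  by have := min_d (k %% d)%N; rewrite r_gt0 Hr leqNgt ltn_pmod // => /(_ isT).
rewrite mulg1 addn0; apply: qz_eq_trans (qz_homX _ homH Hd) _.
by rewrite mulrnA -[_ *+ d]mulr_natr mulfVK ?pnatr_eq0 -?lt0n //; apply: qz_eq_refl.
Qed.

(** * From a central extension to a nonzero class in B_0 *)

(* The central extension of [set: gT] / <[z]> by <[z]> represents a nonzero class of B0. *)
Definition B0_cover (gT : finGroupType) (z : gT) : Prop :=
  [/\ prime #[z]%g, forall x, commute x z, z \in [~: [set: gT], [set: gT]]%g &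
      forall x y, ([~ x, y] \in <[z]> -> [~ x, y] = 1)%g].

Lemma qz_hom_commutator (gT : finGroupType) (G : {group gT}) chi :
  qz_hom G chi -> {in [~: G, G]%g, forall u, qz_eq (chi u) 0}.
Proof.
move=> homG u /gen_prodgP[n [c cP ->]].
have chi1 := qz_hom1 homG.
have chiV v : v \in G -> qz_eq (chi v^-1)%g (- chi v).
  move=> Gv; have := homG _ _ (groupVr Gv) Gv; rewrite mulVg => h.
  by rewrite /qz_eq opprK; have := qz_eq_trans (qz_eq_sym h) chi1; rewrite /qz_eq subr0.
suff [] : (\prod_(i < n) c i)%g \in G /\ qz_eq (chi (\prod_(i < n) c i)%g) 0 by [].
elim/big_ind: _ => [|a b [Ga a0] [Gb b0]|i _]; first by split.
  split; first exact: groupM.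
  by apply: qz_eq_trans (homG _ _ Ga Gb) _; rewrite -[0]addr0; apply: qz_eqD.
case/imset2P: (cP i) => x y Gx Gy ->; split; first by rewrite groupR.
rewrite commgEl conjgE; apply: qz_eq_trans (homG _ _ _ _) _; rewrite ?groupM ?groupV //.
have -> : 0 = - chi x + (- chi y + (chi x + chi y)) by ring.
apply: qz_eqD (chiV _ Gx) _.
apply: qz_eq_trans (homG _ _ _ _) _; rewrite ?groupM ?groupV //.
exact: qz_eqD (chiV _ Gy) (homG _ _ Gx Gy).
Qed.

Lemma card_central_quotient (gT : finGroupType) (z : gT) :
  (forall x, commute x z) -> #|([set: gT] / <[z]>)%g| = (#|gT| %/ #[z]%g)%N.
Proof.
move=> cz; have nZ : [set: gT] \subset 'N(<[z]>)%g.
  by rewrite cents_norm // cent_cycle; apply/subsetP=> x _; apply/cent1P.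
by rewrite card_quotient // -divgS ?subsetT // cardsT.
Qed.

Lemma B0_cover_nontrivial (gT : finGroupType) (z : gT) :
  B0_cover z -> B0_nontrivial ([set: gT] / <[z]>)%G.
Proof.
move=> [pr_z cz z_comm noncomm]; set Z := <[z]>%G.
have nZ x : x \in ('N(Z))%g.
  by rewrite (subsetP (cent_sub _)) //= cent_cycle; apply/cent1P.
have cZ x u : u \in Z -> commute u x.
  by move=> /cycleP[k ->]; apply/commute_sym/commuteX.
have Z_1 : (1 : {set gT})%g \subset Z by rewrite sub1G.
(* Adjoining z to the trivial group gives the character z |-> 1/p of <z>. *)
have [|k xk1|] := @qz_hom_adjoin gT Z 1%G z (fun=> 0) (1 / #[z]%g%:R)
  (cycle_abelian z) Z_1 (cycle_id z).
- by move=> u v _ _; apply: qz_eq_refl.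
- move: xk1; rewrite inE -order_dvdn => /dvdnP[l ->].
  rewrite mulnC mulrnA -[_ *+ #[z]%g]mulr_natr mulfVK ?pnatr_eq0 -?lt0n ?order_gt0 //.
  by rewrite /qz_eq sub0r rpredN rpredMn.
rewrite joing1G => chi hom_chi chi_z.
pose Q := coset_of Z; pose s (a : Q) : gT := repr a.
have sK a : coset Z (s a) = a by apply: coset_reprK.
have cosM u v : coset Z (u * v)%g = (coset Z u * coset Z v)%g by rewrite morphM.
have cosV u : coset Z u^-1%g = (coset Z u)^-1%g by rewrite morphV.
have Zcos u : coset Z u = 1%g -> u \in Z by move=> /coset_idr ->.
(* The factor set of the section [s]; the class sought is its image under [chi]. *)
pose e a b := (s a * s b * (s (a * b)%g)^-1)%g.
have eE a b : (s a * s b = e a b * s (a * b))%g by rewrite mulgKV.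
have Ze a b : e a b \in Z by apply: Zcos; rewrite !cosM cosV !sK mulgV.
exists (fun a b => chi (e a b)); split; first split.
- move=> a b c _ _ _.
  (* Associativity: multiplied by s (abc), both sides become s a * s b * s c. *)
  have ee : (e b c * e a (b * c) = e a b * e (a * b) c)%g.
    apply: (mulIg (s (a * b * c)%g)).
    have -> : (e a b * e (a * b) c * s (a * b * c) = s a * s b * s c)%g.
      by rewrite -mulgA -eE mulgA -eE.
    by rewrite -(mulgA a) -mulgA -eE mulgA (cZ (s a) _ (Ze b c)) -mulgA -eE mulgA.
  have := qz_eq_trans (qz_eq_sym (hom_chi _ _ (Ze b c) (Ze a (b * c)%g))) _.
  rewrite ee => /(_ _ (hom_chi _ _ (Ze a b) (Ze (a * b)%g c))).
  by rewrite /qz_eq subr0; congr (_ \is a _); ring.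
- move=> A [_ [x [y defA]]].
  have [_ defA' cxy _] := dprodP defA.
  have cxyx : commute x y.
    by apply/commute_sym; apply: (centsP cxy); apply: cycle_id.
  have csxy : commute (s x) (s y).
    apply/commgP/eqP/noncomm/Zcos.
    by rewrite morphR //= !sK; apply/eqP/commgP.
  (* [B] is abelian and contains the lifts of A, so [chi] extends to it in two steps, adjoining s x
     and then s y. *)
  pose H1 := (Z <*> <[s x]>)%G; pose B := (H1 <*> <[s y]>)%G.
  have cZx w : <[w]>%g \subset 'C(Z)%g.
    by rewrite cycle_subG; apply/centP=> u /(cZ w)/commute_sym.
  have abH1 : abelian H1 by rewrite abelianY !cycle_abelian cZx.
  have abB : abelian B.
    by rewrite abelianY abH1 cycle_abelian centY subsetI cZx cent_cycle cycle_subG; apply/cent1P.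
  have sH1B : H1 \subset B by apply: joing_subl.
  have sZH1 : Z \subset H1 by apply: joing_subl.
  have Bx : s x \in B by rewrite (subsetP sH1B) // (subsetP (joing_subr _ _)) ?cycle_id.
  have By : s y \in B by rewrite (subsetP (joing_subr _ _)) ?cycle_id.
  have [chi1 hom1 chi1E] := qz_hom_extend abB (subset_trans sZH1 sH1B) Bx hom_chi.
  have [chi2 hom2 chi2E] := qz_hom_extend abB sH1B By hom1.
  have Bs a : a \in A -> s a \in B.
    rewrite -defA' => /mulsgP[_ _ /cycleP[i ->] /cycleP[j ->] def_a].
    rewrite -(mulgKV (s x ^+ i * s y ^+ j)%g (s a)) groupM //; last by rewrite groupM ?groupX.
    rewrite (subsetP (subset_trans sZH1 sH1B)) //; apply: Zcos.
    by rewrite cosM cosV cosM !morphX //= !sK def_a mulgV.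
  (* Applying [chi2] to s a * s b = e a b * s (ab) exhibits the class as a coboundary on A. *)
  exists (chi2 \o s) => a b Aa Ab /=.
  have Be : e a b \in B by rewrite !groupM ?groupV ?Bs ?groupM.
  have ef : qz_eq (chi2 (e a b)) (chi (e a b)).
    by apply: qz_eq_trans (chi2E _ _) (chi1E _ _) => //; apply: (subsetP sZH1).
  apply: qz_eq_trans (qz_eq_sym ef) _.
  have h1 := hom2 _ _ (Bs _ Aa) (Bs _ Ab).
  have := qz_eqD (qz_eq_trans (qz_eq_sym (hom2 _ _ Be (Bs _ (groupM Aa Ab)))) _)
    (qz_eq_refl (- chi2 (s (a * b)%g))).
  rewrite -eE => /(_ _ h1); rewrite addrK /qz_eq; congr (_ \is a _); ring.
- move=> [g gE].
  have fE a b : qz_eq (chi (e a b)) (g b - g (a * b)%g + g a).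
    have Ga (c : Q) : c \in ([set: gT] / Z)%g by rewrite -(sK c) mem_quotient ?inE.
    exact: gE.
  pose r u := (u * (s (coset Z u))^-1)%g.
  have Zr u : r u \in Z by apply: Zcos; rewrite cosM cosV sK mulgV.
  have rE u : (r u * s (coset Z u) = u)%g by rewrite mulgKV.
  (* A cochain g trivialising the class on the whole quotient would make this a character of the
     whole group, via u = r u * s (coset u). *)
  pose psi u := chi (r u) + g (coset Z u).
  have hom_psi : qz_hom [set: gT] psi.
    move=> u v _ _; rewrite /psi cosM.
    have -> : (r (u * v) = r u * r v * e (coset Z u) (coset Z v))%g.
      apply: (mulIg (s (coset Z u * coset Z v))%g).
      rewrite -[RHS]mulgA -eE -cosM rE mulgA -(mulgA (r u)).
      by rewrite (cZ (s (coset Z u)) _ (Zr v)) (mulgA (r u)) rE -mulgA rE.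
    have h1 := hom_chi _ _ (groupM (Zr u) (Zr v)) (Ze (coset Z u) (coset Z v)).
    have h2 := hom_chi _ _ (Zr u) (Zr v).
    have := qz_eqD (qz_eq_trans h1 (qz_eqD h2 (fE _ _))) (qz_eq_refl (g (coset Z u * coset Z v)%g)).
    by rewrite /qz_eq; congr (_ \is a _); ring.
  have psi1 := qz_hom1 hom_psi.
  have psiz := qz_hom_commutator hom_psi z_comm.
  have Zz : z \in Z by apply: cycle_id.
  have cosz : coset Z z = coset Z 1 by rewrite coset_id ?morph1.
  have h := hom_chi _ _ Zz (Zr 1%g).
  (* Since z and 1 have the same coset, the contribution of g and of the section is the same at
     both, and psi z - psi 1 is chi z. As psi kills commutators, 1/p would be an integer. *)
  have {h} psiz' : qz_eq (psi z) (chi z + psi 1%g).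
    rewrite /psi /r cosz addrA; apply: qz_eqD (qz_eq_refl _).
    by move: h; rewrite /r mul1g.
  have chi_z0 : qz_eq (chi z) 0.
    have := qz_eqD (qz_eq_trans (qz_eq_sym psiz') psiz) (qz_eqN psi1).
    by rewrite addrK oppr0 addr0.
  have := chi_z 1%g 1%N (group1 _); rewrite mul1g expg1 mulr1n add0r.
  move=> /qz_eq_sym/qz_eq_trans/(_ chi_z0); rewrite /qz_eq subr0 => int_p.
  have p_gt1 : 1 < #[z]%g%:R :> rat by rewrite ltr1n prime_gt1.
  have : (#[z]%g%:R^-1 : rat) \is a Num.nat.
    by rewrite natrEint -[_^-1]mul1r int_p divr_ge0 ?ler01 ?ler0n.
  case/natrP=> [[|k]] Ek; have := p_gt1.
    by rewrite -[_%:R]invrK Ek invr0 ltr10.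
  by rewrite -invf_lt1 ?Ek ?ltr0n ?order_gt0 // ltrn1.
Qed.

(** * The group of triples: 'F_p acting on a central extension of M *)

HB.saturate prod.

(* The data for 'F_p acting on the central extension of tw_mod by 'F_p with cocycle
   tw_form.  As tw_act i need not preserve tw_form, it lifts to the automorphism
   (m, c) |-> (tw_act i m, c + tw_quad i m). *)
Record twist_data (p : nat) := TwistData {
  tw_mod :> finZmodType;
  tw_act : 'F_p -> tw_mod -> tw_mod;
  tw_form : tw_mod -> tw_mod -> 'F_p;
  tw_quad : 'F_p -> tw_mod -> 'F_p;
  tw_act0 : forall m, tw_act 0 m = m;
  tw_actA : forall i j m, tw_act (i + j) m = tw_act j (tw_act i m);
  tw_actD : forall i m n, tw_act i (m + n) = tw_act i m + tw_act i n;
  tw_formDl : forall m n k, tw_form (m + n) k = tw_form m k + tw_form n k;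
  tw_formDr : forall m n k, tw_form m (n + k) = tw_form m n + tw_form m k;
  tw_quadA : forall i j m, tw_quad (i + j) m = tw_quad i m + tw_quad j (tw_act i m);
  tw_quadD : forall i m n, tw_quad i (m + n) =
    tw_quad i m + tw_quad i n + (tw_form (tw_act i m) (tw_act i n) - tw_form m n)
}.

(* A triple (i, m, c) stands for the product of i in 'F_p and (m, c), in this order. *)
Definition twist p (D : twist_data p) : Type := ('F_p * D * 'F_p)%type.
HB.instance Definition _ p (D : twist_data p) := Finite.on (twist D).

Definition twist_one p (D : twist_data p) : twist D := (0, 0, 0).

(** Moving (m, c) past j turns it into (tw_act j m, c + tw_quad j m), which is then multiplied by
    (n, d) with cocycle [tw_form]. *)
Definition twist_mul p (D : twist_data p) (g h : twist D) : twist D :=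
  let: (i, m, c) := g in let: (j, n, d) := h in
  (i + j, tw_act j m + n, c + tw_quad j m + d + tw_form (tw_act j m) n).

Definition twist_inv p (D : twist_data p) (g : twist D) : twist D :=
  let: (i, m, c) := g in let n := tw_act (- i) (- m) in
  (- i, n, - (tw_quad i n + c + tw_form (- m) m)).

Lemma tw_form0l p (D : twist_data p) (m : D) : tw_form 0 m = 0.
Proof. by apply: (addrI (tw_form 0 m)); rewrite -tw_formDl !addr0. Qed.

Lemma tw_form0r p (D : twist_data p) (m : D) : tw_form m 0 = 0.
Proof. by apply: (addrI (tw_form m 0)); rewrite -tw_formDr !addr0. Qed.

Lemma tw_actr0 p (D : twist_data p) i : tw_act i (0 : D) = 0.
Proof. by apply: (addrI (tw_act i 0)); rewrite -tw_actD !addr0. Qed.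

Lemma tw_quadr0 p (D : twist_data p) i : tw_quad i (0 : D) = 0.
Proof.
have := @tw_quadD p D i 0 0; rewrite addr0 tw_actr0 subrr addr0 => q0.
by apply: (addrI (tw_quad i (0 : D))); rewrite -q0 addr0.
Qed.

Lemma tw_quad0 p (D : twist_data p) (m : D) : tw_quad 0 m = 0.
Proof.
by apply: (addrI (tw_quad 0 m)); rewrite -{2}(tw_act0 m) -tw_quadA !addr0.
Qed.

Lemma twist_mulA p (D : twist_data p) : associative (@twist_mul p D).
Proof.
case=> [[i m] c] [[j n] d] [[k l] e] /=; rewrite !tw_actD -!tw_actA !addrA.
congr (_, _, _); rewrite tw_quadA tw_quadD !tw_formDl tw_formDr -!tw_actA; ring.
Qed.

Lemma twist_mul1 p (D : twist_data p) : left_id (@twist_one p D) (@twist_mul p D).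
Proof. by case=> [[i m] c]; rewrite /= tw_actr0 tw_quadr0 tw_form0l !add0r addr0. Qed.

Lemma twist_mulV p (D : twist_data p) :
  left_inverse (@twist_one p D) (@twist_inv p D) (@twist_mul p D).
Proof.
case=> [[i m] c] /=; rewrite -tw_actA !addNr tw_act0 addNr.
by congr (_, _, _); ring.
Qed.

HB.instance Definition _ p (D : twist_data p) := Finite_isGroup.Build (twist D)
  (@twist_mulA p D) (@twist_mul1 p D) (@twist_mulV p D).

Lemma card_twist p (D : twist_data p) : prime p -> #|{: twist D}| = (p ^ 2 * #|D|)%N.
Proof. by move=> pr_p; rewrite !card_prod card_Fp //; ring. Qed.

Lemma twist_mulE p (D : twist_data p) (g h : twist D) : (g * h)%g = twist_mul g h.
Proof. by []. Qed.

Lemma twist_fst p (D : twist_data p) (g h : twist D) : (g * h)%g.1.1 = g.1.1 + h.1.1.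
Proof. by case: g h => [[i m] c] [[j n] d]. Qed.

Lemma twist_fstV p (D : twist_data p) (g : twist D) : g^-1%g.1.1 = - g.1.1.
Proof. by case: g => [[i m] c]. Qed.

Lemma twist_fstX p (D : twist_data p) (g : twist D) k : (g ^+ k)%g.1.1 = g.1.1 *+ k.
Proof. by elim: k => // k IHk; rewrite expgS twist_fst IHk mulrS. Qed.

(* If [g, h] is in <z>, then g and h may be changed to generators of <g, h> of which
   one is in the kernel of the projection to 'F_p; fix_w handles this case. *)
Lemma twist_cover p (D : twist_data p) (w : D) :
    prime p -> w != 0 -> w *+ p = 0 ->
    (forall i, tw_act i w = w) -> (forall i, tw_quad i w = 0) ->
    (forall m, tw_form w m = 0) -> (forall m, tw_form m w = 0) ->
    (exists i m, tw_act i m = m + w) ->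
    (exists m n : D, tw_form m n - tw_form n m = 1) ->
    (forall i m k, i != 0 -> tw_act i m + w *+ k = m ->
       [/\ forall n, tw_form m n = 0, forall n, tw_form n m = 0 & tw_quad i m = 0]) ->
  B0_cover ((0, w, 1) : twist D) /\ #[(0, w, 1)%R : twist D]%g = p.
Proof.
move=> pr_p w_neq0 pw0 act_w quad_w wB Bw ex_w ex_form fix_w.
pose E := twist D; pose z : E := (0, w, 1); change (B0_cover z /\ #[z]%g = p).
have XB (x : D) k : tw_form x (w *+ k) = 0.
  by elim: k => [|k IHk]; rewrite ?tw_form0r // mulrS tw_formDr Bw IHk addr0.
have BX (x : D) k : tw_form (w *+ k) x = 0.
  by elim: k => [|k IHk]; rewrite ?tw_form0l // mulrS tw_formDl wB IHk addr0.
have zX k : (z ^+ k)%g = (0, w *+ k, k%:R) :> E.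
  elim: k => [|k IHk] //; rewrite expgS IHk twist_mulE /=.
  by rewrite tw_act0 tw_quad0 XB !addr0 -mulrS -natr1 [1 + _]addrC.
have charp : p%:R = 0 :> 'F_p by apply/eqP; rewrite -(dvdn_pcharf (pchar_Fp pr_p)).
have oz : #[z]%g = p.
  apply/(nt_prime_order pr_p); first by rewrite zX pw0 charp.
  by apply/eqP=> -[/eqP]; rewrite (negPf w_neq0).
have wX0 k : w *+ k = 0 -> (z ^+ k = 1 :> E)%g.
  move=> wk0; apply/eqP; rewrite -order_dvdn oz.
  have <- : #[w]%g = p by apply: nt_prime_order; rewrite ?FinRing.zmodXgE.
  by rewrite order_dvdn FinRing.zmodXgE wk0.
have cz (g : E) : commute g z.
  case: g => [[i m] c]; rewrite /commute !twist_mulE /= act_w quad_w wB !tw_act0 tw_quad0 Bw.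
  by rewrite add0r addr0 (addrC w) !addr0 (addrC 1).
have comm1 (g n : E) : g.1.1 != 0 -> n.1.1 = 0 -> ([~ g, n] \in <[z]> -> [~ g, n] = 1)%g.
  (* If the commutator is z^k, its component in M gives the equation of [fix_w] for n. All form and
     quadratic terms then vanish, and the last component leaves k = 0 in 'F_p. *)
  case: g n => [[i m] c] [[j n] d] /= i_neq0 -> /cycleP[k Ek]; rewrite Ek.
  have := commgC ((i, m, c) : E) (0, n, d); rewrite Ek zX !twist_mulE /=.
  rewrite !tw_act0 !tw_quad0 XB !addr0 => eq_gn.
  have /(congr1 (fun u => u.1.2)) /= Em := eq_gn.
  have /(congr1 snd) /= Ec := eq_gn.
  have fix_n : tw_act i n + w *+ k = n.
    by apply: (addrI m); rewrite Em addrA (addrC m).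
  have [nB Bn qn] := fix_w _ _ _ i_neq0 fix_n.
  have act_nB : tw_form (tw_act i n) m = 0.
    by have := nB m; rewrite -{1}fix_n tw_formDl BX addr0.
  rewrite -zX; apply/eqP; rewrite -order_dvdn oz (dvdn_pcharf (pchar_Fp pr_p)).
  move: Ec; rewrite Bn qn act_nB !addr0 (addrC c) -{1}[d + c]addr0 => /addrI <-.
  exact: eqxx.
have [i0 [m0 act_m0]] := ex_w; have [m1 [n1 form_mn]] := ex_form.
(* The action yields the commutator (0, w, c) and the form yields (0, 0, 1); the (1 - c)-th power of
   the latter corrects the former to z. *)
pose c := tw_quad i0 m0; pose k : nat := ((1 - c)%R : 'F_p).
have comm2 (g h x : E) : (g * h = h * g * x)%g -> x \in [~: [set: E], [set: E]]%g.
  by rewrite commgC => /mulgI <-; apply: mem_commg; rewrite inE.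
pose y : E := (0, 0, 1); pose x : E := (0, w, c).
have zE : z = (x * y ^+ k)%g :> E.
  have -> : (y ^+ k)%g = (0, 0, k%:R) :> E.
    elim: k => // k IHk; rewrite expgS IHk twist_mulE /= tw_actr0 tw_quadr0 tw_form0r.
    by rewrite !addr0 -natr1 addrC.
  by rewrite twist_mulE /= tw_act0 tw_quad0 tw_form0r !addr0 /k natr_Zp subrKC.
split=> //; split; [by rewrite oz | exact: cz | | ].
  rewrite zE groupM ?groupX //.
    apply: (comm2 (0, m0, 0) (i0, 0, 0)); rewrite !twist_mulE /= !tw_act0 tw_form0r tw_quadr0.
    by rewrite tw_form0l Bw !tw_quad0 act_m0 !addr0 !add0r.
  apply: (comm2 (0, m1, 0) (0, n1, 0)); rewrite !twist_mulE /= !tw_act0.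
  rewrite tw_form0r !tw_quad0 -form_mn.
  by rewrite !addr0 !add0r (addrC m1) subrKC.
move=> g h gh; case: (eqVneq g.1.1 0) => [g0|]; last first.
  move=> g_n0; pose l : nat := ((h.1.1 / g.1.1)%R : 'F_p).
  pose n := (g ^- l * h)%g.
  have def_h : h = (g ^+ l * n)%g by rewrite mulKVg.
  have def_gh : [~ g, h]%g = [~ g, n]%g.
    by rewrite def_h commgMJ (_ : [~ g, g ^+ l] = 1)%g ?conj1g ?mulg1 //; apply/eqP/commgP/commuteX.
  rewrite def_gh; apply: comm1 => //; rewrite -?def_gh //.
  by rewrite twist_fst twist_fstV twist_fstX -mulr_natr natr_Zp mulrCA divff // mulr1 addNr.
case: (eqVneq h.1.1 0) => [h0|h_n0]; last first.
  move: gh; rewrite -invg_comm groupV => gh.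
  by rewrite (comm1 h g) ?invg1.
(* Both elements lie over the abelian group M, so the commutator z^l has component w l = 0 there and
   is trivial. *)
case: g h g0 h0 gh => [[i m] c'] [[j n] d] /= -> -> /cycleP[l El]; rewrite El.
have := commgC ((0, m, c') : E) (0, n, d); rewrite El zX !twist_mulE /= !tw_act0.
move=> /(congr1 (fun u => u.1.2)) /= Em; rewrite -zX; apply: wX0.
by move: Em; rewrite (addrC n) -{1}[m + n]addr0 => /addrI <-.
Qed.

(** * Multiples in products and reduction from Z/n to 'F_p *)

Lemma pair_mulrn (U V : nmodType) (u : U) (v : V) k : (u, v) *+ k = (u *+ k, v *+ k).
Proof. by elim: k => // k IHk; rewrite !mulrS IHk. Qed.

Definition Zp_red n p (x : 'Z_n) : 'F_p := (x : nat)%:R.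

Lemma natr_mod_Fp n p a : prime p -> (p %| n)%N -> (a %% n)%:R = a%:R :> 'F_p.
Proof.
move=> pr_p p_n; have /eqP n0 : n%:R == 0 :> 'F_p by rewrite -(dvdn_pcharf (pchar_Fp pr_p)).
by rewrite {2}(divn_eq a n) natrD natrM n0 mulr0 add0r.
Qed.

Lemma Zp_red_is_zmod_morphism n p : (1 < n)%N -> prime p -> (p %| n)%N ->
  zmod_morphism (@Zp_red n p).
Proof.
move=> n_gt1 pr_p p_n x y; apply: (addIr (Zp_red p y)); rewrite subrK.
have p_n' : (p %| (Zp_trunc n).+2)%N by rewrite Zp_cast.
by rewrite -{2}(subrK y x) /Zp_red -natrD -[LHS](natr_mod_Fp _ pr_p p_n').
Qed.

(** * Primes p > 3: truncated polynomials *)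

Lemma Fp_nat23_neq0 p : prime p -> (3 < p)%N -> (2 : 'F_p) != 0 /\ (3 : 'F_p) != 0.
Proof.
move=> pr_p p_gt3; rewrite -!(dvdn_pcharf (pchar_Fp pr_p)).
by split; apply: contraL p_gt3 => /dvdn_leq; rewrite -leqNgt => /(_ isT) // /leqW.
Qed.

(** Binomial coefficients as polynomials in i, meaningful for i in 'F_p once 6 is invertible. *)
Definition bin2F (F : fieldType) (i : F) := i * (i - 1) / 2.
Definition bin3F (F : fieldType) (i : F) := i * (i - 1) * (i - 2) / (2 * 3).

(* The action of 1 + t on F[t]/(t^4), with basis 1, t, t^2, t^3, raised to the power i
   by the binomial formula; w will be t^3. *)
Definition unip_act (F : fieldType) (i : F) (m : F * F * F * F) : F * F * F * F :=
  let: (x, y, u, v) := m in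
  (x, y + i * x, u + i * y + bin2F i * x, v + i * u + bin2F i * y + bin3F i * x).

Definition unip_form (F : fieldType) (m n : F * F * F * F) : F := m.1.1.1 * n.1.1.2.
(** The action adds i x to y, hence i x x' to [unip_form]; this is the polarisation of i x^2 / 2. *)
Definition unip_quad (F : fieldType) (i : F) (m : F * F * F * F) : F := i * m.1.1.1 ^+ 2 / 2.

Lemma B0_cover_gt3 p : prime p -> (3 < p)%N ->
  exists (gT : finGroupType) (z : gT), [/\ B0_cover z, #[z]%g = p & #|gT| = (p ^ 6)%N].
Proof.
move=> pr_p p_gt3; have [nz2 nz3] := Fp_nat23_neq0 pr_p p_gt3.
have nz6 : (6 : 'F_p) != 0 by rewrite (natrM _ 2 3) mulf_neq0.
pose M : finZmodType := ('F_p * 'F_p * 'F_p * 'F_p)%type.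
pose s : 'F_p -> M -> M := @unip_act 'F_p; pose B : M -> M -> 'F_p := @unip_form 'F_p.
pose q : 'F_p -> M -> 'F_p := @unip_quad 'F_p.
have s0 m : s 0 m = m.
  by case: m => [[[x y] u] v]; rewrite /s /unip_act /bin2F /bin3F;
  congr (_, _, _, _); field; rewrite ?nz6 ?nz2.
have sA i j m : s (i + j) m = s j (s i m).
  by case: m => [[[x y] u] v]; rewrite /s /unip_act /bin2F /bin3F;
  congr (_, _, _, _); field; rewrite ?nz6 ?nz2.
have sD i m n : s i (m + n) = s i m + s i n.
  case: m n => [[[x y] u] v] [[[x' y'] u'] v'].
  by rewrite /s /unip_act /bin2F /bin3F; congr (_, _, _, _); rewrite /=; field; rewrite ?nz6 ?nz2.
have BDl m n k : B (m + n) k = B m k + B n k by rewrite /B /unip_form mulrDl.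
have BDr m n k : B m (n + k) = B m n + B m k by rewrite /B /unip_form mulrDr.
have qA i j m : q (i + j) m = q i m + q j (s i m).
  by case: m => [[[x y] u] v]; rewrite /q /unip_quad /=; field; rewrite ?nz6 ?nz2.
have qD i m n : q i (m + n) = q i m + q i n + (B (s i m) (s i n) - B m n).
  case: m n => [[[x y] u] v] [[[x' y'] u'] v'].
  by rewrite /q /B /unip_quad /unip_form /=; field; rewrite ?nz6 ?nz2.
pose D := TwistData s0 sA sD BDl BDr qA qD; pose w : D := (0, 0, 0, 1).
exists (twist D), ((0, w, 1) : twist D).
have [||||||||i [[[x y] u] v] k i_neq0|cov ord] := @twist_cover p D w pr_p.
- by apply/eqP=> -[/eqP]; rewrite oner_eq0.
- by rewrite !pair_mulrn !mul0rn; congr (_, _); apply/eqP; rewrite -(dvdn_pcharf (pchar_Fp pr_p)).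
- by move=> i; rewrite /= /s /unip_act !mulr0 !addr0.
- by move=> i; rewrite /= /q /unip_quad /= expr0n mulr0 mul0r.
- by move=> m; rewrite /= /B /unip_form mul0r.
- by move=> m; rewrite /= /B /unip_form mulr0.
(* Multiplication by 1 + t sends t^2 to t^2 + t^3. *)
- exists 1, (0, 0, 1, 0); rewrite /= /s /unip_act; congr (_, _, _, _);
  rewrite /= ?mulr0 ?mul1r ?add0r ?addr0 //.
- exists (1, 0, 0, 0), (0, 1, 0, 0); by rewrite /= /B /unip_form /= mulr1 mulr0 subr0.
(* The coefficient of t gives i x = 0, then that of t^2 gives i y = 0; the form and the quadratic
   map involve only x and y. *)
- rewrite !pair_mulrn !mul0rn; move=> eq_m.
  have /(congr1 (fun m => m.1.1.2)) /= := eq_m; rewrite addr0 -[RHS]addr0 => /addrI/eqP.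
  rewrite mulf_eq0 (negPf i_neq0) /= => /eqP x0.
  have /(congr1 (fun m => m.1.2)) /= := eq_m; rewrite x0 mulr0 !addr0 -[RHS]addr0 => /addrI/eqP.
  rewrite mulf_eq0 (negPf i_neq0) /= => /eqP y0.
  rewrite y0 /B /q /unip_form /unip_quad /=.
  by split=> [n|n|]; rewrite /= ?mul0r ?mulr0 // expr0n mulr0 mul0r.
split=> //; rewrite card_twist // !card_prod card_Fp //; ring.
Qed.

(** * The prime 3: Eisenstein integers modulo 9 *)

Definition red9 : 'Z_9 -> 'F_3 := @Zp_red 9 3.
HB.instance Definition _ := GRing.isZmodMorphism.Build 'Z_9 'F_3 red9
  (@Zp_red_is_zmod_morphism 9 3 isT isT isT).

(* Multiplication by zeta^i on Z[zeta]/(9), zeta a cube root of unity, in the basis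
   1, zeta - 1.  It replaces F[t]/(t^4), on which (1 + t)^3 <> 1 if F = 'F_3. *)
Definition zeta_act (i : 'F_3) (m : 'Z_9 * 'Z_9) : 'Z_9 * 'Z_9 :=
  match val i with
  | 0%N => m
  | 1%N => (m.1 - m.2 *+ 3, m.1 - m.2 *+ 2)
  | _ => (m.2 *+ 3 - m.1 *+ 2, m.2 - m.1)
  end.

Lemma F3_ind (P : 'F_3 -> Prop) : P 0 -> P 1 -> P 2 -> forall i, P i.
Proof.
move=> P0 P1 P2 [[|[|[|//]]] lt].
- by rewrite (_ : Ordinal lt = 0) //; apply: val_inj.
- by rewrite (_ : Ordinal lt = 1) //; apply: val_inj.
- by rewrite (_ : Ordinal lt = 2) //; apply: val_inj.
Qed.

Lemma zeta_actA i j m : zeta_act (i + j) m = zeta_act j (zeta_act i m).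
Proof.
case: m => x y; elim/F3_ind: i; elim/F3_ind: j; congr (_, _); rewrite /=; ring.
Qed.

Lemma zeta_actD i m n : zeta_act i (m + n) = zeta_act i m + zeta_act i n.
Proof. case: m n => [x y] [x' y']; elim/F3_ind: i; congr (_, _); rewrite /=; ring. Qed.

Lemma red9_mul3n (x : 'Z_9) : red9 (x *+ 3) = 0.
Proof. by rewrite (raddfMn red9) /=; move: (red9 x); elim/F3_ind; apply/eqP. Qed.

Lemma red9_eq0 (x : 'Z_9) : x *+ 3 = 0 -> red9 x = 0.
Proof.
by case: x => -[|[|[|[|[|[|[|[|[|//]]]]]]]]] lt // _; apply: val_inj.
Qed.

Lemma B0_cover_3 : exists (gT : finGroupType) (z : gT),
  [/\ B0_cover z, #[z]%g = 3 & #|gT| = (3 ^ 6)%N].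
Proof.
pose M : finZmodType := ('Z_9 * 'Z_9)%type.
pose s : 'F_3 -> M -> M := zeta_act; pose B (m n : M) : 'F_3 := red9 m.1 * red9 n.2.
(* Again i x^2 / 2, since 1/2 = -1 in 'F_3. *)
pose q (i : 'F_3) (m : M) : 'F_3 := - (i * red9 m.1 ^+ 2).
have s0 m : s 0 m = m by [].
have BDl m n k : B (m + n) k = B m k + B n k by rewrite /B (raddfD red9) mulrDl.
have BDr m n k : B m (n + k) = B m n + B m k by rewrite /B (raddfD red9) mulrDr.
have redX i m : red9 (s i m).1 = red9 m.1.
  case: m => x y; elim/F3_ind: i => //=; rewrite (raddfB red9) /= red9_mul3n ?subr0 ?sub0r //.
  by rewrite (raddfMn red9) /=; move: (red9 x); elim/F3_ind; apply/eqP.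
have redY i m : red9 (s i m).2 = red9 m.2 + i * red9 m.1.
  case: m => x y; elim/F3_ind: i => //=; rewrite ?mul0r ?addr0 // (raddfB red9) ?(raddfMn red9) /=;
  move: (red9 x) (red9 y); elim/F3_ind; elim/F3_ind; exact/eqP.
have qA i j m : q (i + j) m = q i m + q j (s i m) by rewrite /q redX; ring.
have qD i m n : q i (m + n) = q i m + q i n + (B (s i m) (s i n) - B m n).
  rewrite /q /B redX redY (raddfD red9) /=.
  move: (red9 m.1) (red9 n.1) (red9 n.2) => x y z.
  have three0 : (3 : 'F_3) = 0 by apply/eqP.
  apply/eqP; rewrite -subr_eq0 (_ : _ - _ = - (i * x * y) * 3); last by ring.
  by rewrite three0 mulr0.
pose D := TwistData s0 (zeta_actA : forall i j m, s (i + j) m = s j (s i m))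
  (zeta_actD : forall i m n, s i (m + n) = s i m + s i n) BDl BDr qA qD.
(* Put t = zeta - 1. As 3 is a unit times t^2, this element 3 t generates t^3 M, and t^4 M = 0. *)
pose w : D := (0, 3).
exists (twist D), ((0, w, 1) : twist D).
have red_w1 : red9 w.1 = 0 by apply: (raddf0 red9).
have red_w2 : red9 3 = 0 by apply: val_inj.
have [||||||||i [x y] k i_neq0|cov ord] := @twist_cover 3 D w isT.
- by [].
- by apply/eqP.
- by elim/F3_ind; apply/eqP.
- by move=> i; rewrite /= /q red_w1 expr0n mulr0 oppr0.
- by move=> m; rewrite /= /B red_w1 mul0r.
- by move=> m; rewrite /= /B red_w2 mulr0.
- by exists 1, (3, 0); apply/eqP.
- by exists (1, 0), (0, 1); apply/eqP.
- rewrite pair_mulrn => eq_m.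
  (* As zeta^i - 1 is a unit times t, the equation puts t m in t^3 M, so m lies in t^2 M = 3 M. The
     two values of i are checked in coordinates. *)
  have [x0 y0] : red9 x = 0 /\ red9 y = 0.
    have /(congr1 fst) /= := eq_m; have /(congr1 snd) /= := eq_m; move: i_neq0.
    elim/F3_ind: i {eq_m} => //= _ => [yE xE | yE xE].
      have y0 : red9 y = 0.
        by apply: red9_eq0; apply: oppr_inj; apply: (addrI x);
        rewrite oppr0 addr0 -[RHS]xE mul0rn addr0.
      split=> //; have := congr1 red9 yE.
      rewrite (raddfD red9) (raddfB red9) (raddfMn red9 _ y).
      rewrite (raddfMn red9 _ 3) /= y0 red_w2 !mul0rn.
      by rewrite subr0 addr0.
    have xk : x = 3 *+ k.
      by apply: oppr_inj; apply: (addrI y); apply: (addIr (3 *+ k)); rewrite yE subrK.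
    split; first by rewrite xk (raddfMn red9) /= red_w2 mul0rn.
    apply: red9_eq0; move: xE; rewrite mul0rn addr0 => /(canRL (subrK _)) ->.
    by rewrite -mulrS xk -mulrnA mulnC mulrnA (_ : 3 *+ 3 = 0) ?mul0rn //; apply/eqP.
  rewrite /= /B /q x0 y0.
  by split=> [n|n|]; rewrite /= ?mul0r ?mulr0 // expr0n mulr0 oppr0.
by split=> //; rewrite card_twist // card_prod !card_ord.
Qed.

(** * The prime 2: inversion on Z/8 *)

Definition red8 : 'Z_8 -> 'F_2 := @Zp_red 8 2.
HB.instance Definition _ := GRing.isZmodMorphism.Build 'Z_8 'F_2 red8
  (@Zp_red_is_zmod_morphism 8 2 isT isT isT).

(** Inversion on Z/8 produces w = 4 from 2, as -2 = 2 + 4. The unipotent block on the last two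
    coordinates forces y = 0 on elements fixed up to multiples of w. *)
Definition inv_act (i : 'F_2) (m : 'Z_8 * 'F_2 * 'F_2) : 'Z_8 * 'F_2 * 'F_2 :=
  if i == 0 then m else (- m.1.1, m.1.2, m.2 + m.1.2).

Lemma F2_ind (P : 'F_2 -> Prop) : P 0 -> P 1 -> forall i, P i.
Proof.
move=> P0 P1 [[|[|//]] lt].
- by rewrite (_ : Ordinal lt = 0) //; apply: val_inj.
- by rewrite (_ : Ordinal lt = 1) //; apply: val_inj.
Qed.

Lemma inv_actA i j m : inv_act (i + j) m = inv_act j (inv_act i m).
Proof.
case: m => [[x y] u]; elim/F2_ind: i; elim/F2_ind: j => //; congr (_, _, _).
  by rewrite /= opprK.
by move: u y; elim/F2_ind; elim/F2_ind; exact/eqP.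
Qed.

Lemma inv_actD i m n : inv_act i (m + n) = inv_act i m + inv_act i n.
Proof.
case: m n => [[x y] u] [[x' y'] u']; elim/F2_ind: i => //.
by congr (_, _, _); rewrite /= ?opprD // addrACA.
Qed.

Lemma B0_cover_2 : exists (gT : finGroupType) (z : gT),
  [/\ B0_cover z, #[z]%g = 2 & #|gT| = (2 ^ 7)%N].
Proof.
pose M : finZmodType := ('Z_8 * 'F_2 * 'F_2)%type.
pose s : 'F_2 -> M -> M := inv_act; pose B (m n : M) : 'F_2 := red8 m.1.1 * n.1.2.
(* No correction is required: the action preserves y and the parity of x, hence the form. *)
pose q (i : 'F_2) (m : M) : 'F_2 := 0.
have s0 m : s 0 m = m by [].
have BDl m n k : B (m + n) k = B m k + B n k by rewrite /B (raddfD red8) mulrDl.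
have BDr m n k : B m (n + k) = B m n + B m k by rewrite /B mulrDr.
have qA i j m : q (i + j) m = q i m + q j (s i m) by rewrite /q addr0.
have sB i m n : B (s i m) (s i n) = B m n.
  case: m n => [[x y] u] [[x' y'] u']; elim/F2_ind: i => //.
  rewrite /B /= (raddfN red8) /=; congr (_ * _).
  by move: (red8 x); elim/F2_ind; exact/eqP.
have qD i m n : q i (m + n) = q i m + q i n + (B (s i m) (s i n) - B m n).
  by rewrite sB subrr !addr0.
pose D := TwistData s0 (inv_actA : forall i j m, s (i + j) m = s j (s i m))
  (inv_actD : forall i m n, s i (m + n) = s i m + s i n) BDl BDr qA qD.
pose w : D := (4, 0, 0).
exists (twist D), ((0, w, 1) : twist D).
have red_w : red8 4 = 0 by apply: val_inj.
have [||||||||i [[x y] u] k i_neq0|cov ord] := @twist_cover 2 D w isT.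
- by [].
- by apply/eqP.
- by elim/F2_ind; apply/eqP.
- by [].
- by move=> m; rewrite /= /B red_w mul0r.
- by move=> m; rewrite /= /B mulr0.
- by exists 1, (2, 0, 0); apply/eqP.
- by exists (1, 0, 0), (0, 1, 0); apply/eqP.
- rewrite !pair_mulrn !mul0rn; elim/F2_ind: i i_neq0 => // _ eq_m.
  have /(congr1 (fun m => m.1.1)) /= xE := eq_m.
  have /(congr1 snd) /= := eq_m; rewrite addr0 -[RHS]addr0 => /addrI y0.
  (* From -x + 4 k = x follows 4 x = 8 k = 0 in Z/8, so x is even. *)
  have x0 : red8 x = 0.
    have x2 : x *+ 2 = 4 *+ k by rewrite mulr2n -{1}xE addrAC addNr add0r.
    have : x *+ 4 = 0.
      rewrite (mulrnA x 2 2) x2 -mulrnA mulnC mulrnA (_ : 4 *+ 2 = 0) ?mul0rn //.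
      exact/eqP.
    by clear; case: x => -[|[|[|[|[|[|[|[|//]]]]]]]] lt // _; apply: val_inj.
  rewrite /= /B x0 y0.
  by split=> [n|n|]; rewrite /= ?mul0r ?mulr0.
by split=> //; rewrite card_twist // !card_prod !card_ord.
Qed.

(** * Abelian direct factors and the resulting orders *)

Lemma B0_cover_prod (gT aT : finGroupType) (z : gT) :
    abelian [set: aT] -> B0_cover z ->
  B0_cover ((z, 1%g) : gT * aT) /\ #[(z, 1%g) : gT * aT]%g = #[z]%g.
Proof.
move=> ab_aT [pr_z cz z_comm noncomm].
have oz : #[(z, 1%g) : gT * aT]%g = #[z]%g.
  exact: (order_injm (injm_pairg1 gT aT) (in_setT z)).
split=> //; split; first by rewrite oz.
- by case=> g a; rewrite /commute; congr (_, _); [apply: cz | rewrite mulg1 mul1g].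
- have : (pairg1 aT z) \in (pairg1 aT @* [~: [set: gT], [set: gT]])%g by rewrite mem_morphim ?inE.
  by rewrite morphimR ?subsetT //; apply/subsetP/commgSS; apply: subsetT.
- case=> [g a] [h b] /cycleP[k Ek].
  have comm_ab : [~ a, b]%g = 1%g.
    by apply/eqP/commgP; apply: (centsP ab_aT); rewrite inE.
  have Efst u l : ((u, 1%g) ^+ l = (u ^+ l, 1%g) :> gT * aT)%g.
    by elim: l => // l IHl; rewrite !expgS IHl; congr (_, _); rewrite mulg1.
  have E1 : [~ (g, a), (h, b)]%g = ([~ g, h], [~ a, b])%g :> gT * aT by [].
  rewrite E1 comm_ab (noncomm g h) //.
  by apply/cycleP; exists k; have /(congr1 fst) := Ek; rewrite Efst.
Qed.

Lemma B0_nontrivial_multiple (gT : finGroupType) (z : gT) p k n :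
    B0_cover z -> #[z]%g = p -> #|gT| = (p ^ k.+1)%N -> (0 < n)%N -> (p ^ k %| n)%N ->
  exists (gT' : finGroupType) (G : {group gT'}), #|G| = n /\ B0_nontrivial G.
Proof.
(* The cofactor n / p^k is positive, hence of the form m.+1, and 'I_m.+1 is a cyclic group of that
   order. *)
move=> cov_z oz card_gT n_gt0 /dvdnP[[|m] def_n]; first by rewrite def_n in n_gt0.
have p_gt0 : (0 < p)%N by rewrite -oz order_gt0.
have [cov ord] := @B0_cover_prod gT 'I_m.+1 z (FinRing.zmod_abelian _) cov_z.
eexists _, _; split; last exact: B0_cover_nontrivial cov.
have [_ c _ _] := cov; rewrite /= card_central_quotient // ord oz.
by rewrite card_prod card_ord card_gT expnS -mulnA mulKn // mulnC -def_n.
Qed.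

Theorem theorem1p13 (n : nat) :
  (0 < n)%N ->
  ((2 ^ 6 %| n)%N \/ exists p : nat, [/\ prime p, odd p & (p ^ 5 %| n)%N]) ->
  exists (gT : finGroupType) (G : {group gT}), #|G| = n /\ B0_nontrivial G.
Proof.
move=> n_gt0 [n_div | [p [pr_p odd_p n_div]]].
  have [gT [z [cov oz card_gT]]] := B0_cover_2.
  exact: (B0_nontrivial_multiple cov oz card_gT n_gt0 n_div).
have [gT [z [cov oz card_gT]]] : exists (gT : finGroupType) (z : gT),
    [/\ B0_cover z, #[z]%g = p & #|gT| = (p ^ 6)%N].
  have [p_lt3|p_gt3|->] := ltngtP p 3; last exact: B0_cover_3.
    by case: p pr_p odd_p p_lt3 {n_div} => [|[|[|]]].
  exact: B0_cover_gt3.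
exact: (B0_nontrivial_multiple cov oz card_gT n_gt0 n_div).
Qed.
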